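(* Let $d \geq 1$ and $m \geq 0$ be integers, let $h_1,\dots,h_m : \mathbf{R}^d \to \mathbf{R}$ be Borel measurable functions, and let $\mathcal{A} = \mathbf{R}[x_1,\dots,x_d,h_1,\dots,h_m]$ be the algebra of real-valued functions on $\mathbf{R}^d$ generated (as a unital $\mathbf{R}$-algebra) by the coordinate functions $x_1,\dots,x_d$ and by $h_1,\dots,h_m$. Let $Q \subset \mathcal{A}$ be a countably generated archimedean quadratic module, and assume that $Q$ possesses the moment property. If a function $f \in \mathcal{A}$ satisfies $f(x) > 0$ for all $x \in P(Q)$, then $f \in Q$.
   Context: $\mathcal{A}$ is a commutative unital $\mathbf{R}$-algebra of Borel measurable functions $\mathbf{R}^d \to \mathbf{R}$, with pointwise operations. A quadratic module in $\mathcal{A}$ is a subset $Q \subset \mathcal{A}$ such that $Q + Q \subset Q$, $1 \in Q$, and $a^2 Q \subset Q$ for all $a \in \mathcal{A}$. For a subset $F \subset \mathcal{A}$, the quadratic module generated by $F$ is the smallest subset of $\mathcal{A}$ that is closed under addition and under multiplication by squares $a^2$, $a \in \mathcal{A}$, and contains $F$ and $1$. $Q$ is countably generated if it is the quadratic module generated by some countable set $F$. A quadratic module $Q \subset \mathcal{A}$ is archimedean if $1$ belongs to its algebraic interior: for every $g \in \mathcal{A}$ there exists $\epsilon > 0$ such that $1 + t g \in Q$ for all $0 \leq t \leq \epsilon$. The positivity set of $Q$ is $P(Q) = \{x \in \mathbf{R}^d : q(x) \geq 0 \text{ for all } q \in Q\}$. When $Q$ is countably generated, $P(Q)$ is a Borel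 set. $Q$ has the moment property if every $\mathbf{R}$-linear functional $L : \mathcal{A} \to \mathbf{R}$ with $L(q) \geq 0$ for all $q \in Q$ is represented by a positive Borel measure $\mu$ supported by $P(Q)$, i.e. $\mu(\mathbf{R}^d \setminus P(Q)) = 0$, every $g \in \mathcal{A}$ is $\mu$-integrable, and $L(g) = \int_{P(Q)} g \, d\mu$ for all $g \in \mathcal{A}$. *)

(* Defs.v *)
From HB Require Import structures.
From mathcomp Require Import all_boot all_order all_algebra.
From mathcomp Require Import all_classical all_reals all_analysis.

Set Implicit Arguments.
Unset Strict Implicit.
Unset Printing Implicit Defensive.

Import Order.TTheory GRing.Theory Num.Theory.
Import numFieldNormedType.Exports.

Local Open Scope classical_set_scope.
Local Open Scope ring_scope.

(* Sets of functions T -> R carry the pointwise operations of the library's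
   ring and module structures on function types. *)

Definition unital_subalgebra (R : realType) (T : Type) (A : set (T -> R)) :=
  [/\ A 1,
      forall (a : R) f g, A f -> A g -> A (a *: f + g) &
      forall f g, A f -> A g -> A (f * g)].

Definition generated_algebra (R : realType) (T : Type) (G : set (T -> R)) :
    set (T -> R) :=
  smallest (@unital_subalgebra R T) G.

Definition quadratic_module (R : realType) (T : Type)
    (A Q : set (T -> R)) :=
  [/\ Q `<=` A,
      Q 1,
      forall p q, Q p -> Q q -> Q (p + q) &
      forall a q, A a -> Q q -> Q (a ^+ 2 * q)].

(* Meaningful for F `<=` A only. *)
Definition generated_quadratic_module (R : realType) (T : Type)
    (A F : set (T -> R)) : set (T -> R) :=
  smallest (quadratic_module A) F.

Definition countably_generated (R : realType) (T : Type)
    (A Q : set (T -> R)) :=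
  exists F : set (T -> R),
    [/\ countable F, F `<=` A & Q = generated_quadratic_module A F].

Definition archimedean (R : realType) (T : Type) (A Q : set (T -> R)) :=
  forall g, A g -> exists2 e : R, 0 < e &
    forall t : R, 0 <= t <= e -> Q (1 + t *: g).

Definition positivity_set (R : realType) (T : Type) (Q : set (T -> R)) :
    set T :=
  [set x | forall q, Q q -> 0 <= q x].

(* A linear functional on A is encoded as a function on all of T -> R that is
   linear on A; its values outside A are irrelevant. *)
Definition linear_functional_on (R : realType) (T : Type)
    (A : set (T -> R)) (L : (T -> R) -> R) :=
  forall (a : R) f g, A f -> A g -> L (a *: f + g) = a * L f + L g.

(* To be used when positivity_set Q is measurable, which is the case for
   countably generated Q and measurable functions. *)
Definition moment_property (R : realType) (disp : measure_display)
    (T : measurableType disp) (A Q : set (T -> R)) :=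
  forall L : (T -> R) -> R,
    linear_functional_on A L -> (forall q, Q q -> 0 <= L q) ->
    exists mu : {measure set T -> \bar R},
      mu (~` positivity_set Q) = 0%E /\
      forall g, A g ->
        mu.-integrable setT (EFin \o g) /\
        (L g)%:E = (\int[mu]_(x in positivity_set Q) (g x)%:E)%E.

(* R^d with its Borel sigma-algebra, the one generated by the open sets. *)
Definition borelRd (R : realType) (d : nat) :=
  g_sigma_algebraType (@open 'rV[R]_d).

Definition coordinate (R : realType) (d : nat) (i : 'I_d) : borelRd R d -> R :=
  fun x => (x : 'rV[R]_d) ord0 i.

(* R[x_1, ..., x_d, h_1, ..., h_m] *)
Definition algebra_of (R : realType) (d m : nat)
    (h : 'I_m -> borelRd R d -> R) : set (borelRd R d -> R) :=
  generated_algebra (range (@coordinate R d) `|` range h).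

(* Main.v *)
(** If [f] is not in [Q], then [-1] is not in the convex cone
    [C = Q - R_{>=0} f]: from [-1 = q - t f] with [t > 0] one gets
    [f = (1 + q) / t], and [-1 \in Q] forces [Q = A] because [1] is an order
    unit.  A maximal cone containing [C] and avoiding [-1] yields a linear
    functional [L >= 0] on [C] with [L 1 = 1].  The moment property gives a
    measure for [L]; since [L f <= 0] while [f > 0] on [P(Q)], it vanishes on
    [P(Q)], contradicting [L 1 = 1].  Borel measurability of the elements of
    [A] is read off from their integrability with respect to that measure. *)

Require Import Defs.
From mathcomp Require Import all_boot all_order all_algebra.
From mathcomp Require Import all_classical all_reals all_analysis.
From mathcomp Require Import lra measurable_realfun.

Set Implicit Arguments.
Unset Strict Implicit.
Unset Printing Implicit Defensive.

Import Order.TTheory GRing.Theory Num.Theory.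
Import numFieldNormedType.Exports.

Local Open Scope classical_set_scope.
Local Open Scope ring_scope.

(** * Convex cones and positive functionals *)

Definition convex_cone (R : realType) (V : lmodType R) (C : set V) :=
  [/\ C 0, forall x y, C x -> C y -> C (x + y) &
      forall (t : R) x, 0 <= t -> C x -> C (t *: x)].

Definition linear_subspace (R : realType) (V : lmodType R) (A : set V) :=
  A 0 /\ forall (a : R) x y, A x -> A y -> A (a *: x + y).

Lemma linear_subspaceZ (R : realType) (V : lmodType R) (A : set V) (a : R) x :
  linear_subspace A -> A x -> A (a *: x).
Proof. by move=> [A0 Al] Ax; rewrite -[_ *: _]addr0; exact: Al. Qed.

(** Zorn's lemma gives a maximal [M]. If it contained neither [g] nor [- g], adjoining either ray
    would produce [- u], and a convex combination of the two resulting identities eliminates [g]. *)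
Lemma maximal_cone (R : realType) (V : lmodType R) (A C : set V) (u : V) :
  linear_subspace A -> C `<=` A -> convex_cone C -> ~ C (- u) ->
  exists M, [/\ C `<=` M, M `<=` A, convex_cone M, ~ M (- u) &
                forall g, A g -> M g \/ M (- g)].
Proof.
move=> sA CA [C0 CD CZ] CNu.
(* Absorption of C, rather than C `<=` M, holds also for the empty set, the
   union of the empty chain. *)
pose P (M : set V) := [/\ M `<=` A, forall x y, M x -> M y -> M (x + y),
  forall (t : R) x, 0 <= t -> M x -> M (t *: x), ~ M (- u) &
  forall x y, M x -> C y -> M (x + y)].
have [M [[MA MD MZ MNu MC] Mmax]] : exists M, P M /\ forall B, M `<` B -> ~ P B.
  apply: Zorn_bigcup => F FP Ftot; split.
  - by move=> x [X /FP[XA _ _ _ _]] /XA.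
  - move=> x y [X FX Xx] [Y FY Yy].
    have [XY|YX] := Ftot _ _ FX FY.
      by exists Y => //; have [_ + _ _ _] := FP _ FY; apply => //; exact: XY.
    by exists X => //; have [_ + _ _ _] := FP _ FX; apply => //; exact: YX.
  - move=> t x t0 [X FX Xx]; exists X => //.
    by have [_ _ + _ _] := FP _ FX; exact.
  - by move=> [X /FP[]].
  - move=> x y [X FX Xx] Cy; exists X => //.
    by have [_ _ _ _ +] := FP _ FX; exact.
(* [P] also holds for the empty set, which is not maximal because [C] itself satisfies [P]. *)
have [x0 Mx0] : M !=set0.
  apply/set0P/negP => /eqP M0; apply: (Mmax C); last by split.
  by rewrite M0; split; [exact: sub0set|move=> /(_ _ C0)].
have M0 : M 0 by rewrite -(scale0r x0); exact: MZ.
exists M; split => // [x Cx|g Ag]; first by rewrite -[x]add0r; exact: MC.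
(* By maximality the cone [B], spanned by [M] and [h], violates [P], and the clause that fails is
   the avoidance of [- u]. The coefficient [t] is nonzero since [- u] is not in [M]. *)
have extend h : A h -> ~ M h -> exists t m, [/\ 0 < t, M m & m + t *: h = - u].
  move=> Ah nMh; apply: contrapT => nex.
  pose B := [set x | exists m, exists2 t, M m /\ 0 <= t & x = m + t *: h].
  apply: (Mmax B).
    split=> [x Mx|/(_ h)]; first by exists x, 0; rewrite ?scale0r ?addr0.
    by apply: contra_not nMh; apply; exists 0, 1; rewrite ?scale1r ?add0r.
  split.
  - move=> _ [m [t [Mm t0] ->]]; rewrite addrC; apply: sA.2 => //; exact: MA.
  - move=> _ _ [m [t [Mm t0] ->]] [n [s [Mn s0] ->]].
    exists (m + n), (t + s); last by rewrite addrACA scalerDl.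
    by split; [exact: MD|exact: addr_ge0].
  - move=> a _ a0 [m [t [Mm t0] ->]]; exists (a *: m), (a * t).
      by split; [exact: MZ|exact: mulr_ge0].
    by rewrite scalerDr scalerA.
  - move=> [m [t [Mm]]]; rewrite le_eqVlt => /predU1P[<-|t0] uE.
      by apply: MNu; rewrite uE scale0r addr0.
    by apply: nex; exists t, m.
  - move=> _ y [m [t [Mm t0] ->]] Cy; exists (m + y), t; last by rewrite addrAC.
    by split=> //; exact: MC.
apply: contrapT => /not_orP[nMg nMNg].
have ANg : A (- g) by rewrite -scaleN1r; exact: linear_subspaceZ.
have [t [m [t0 Mm mE]]] := extend _ Ag nMg.
have [s [n [s0 Mn nE]]] := extend _ ANg nMNg.
apply: MNu.
(* Weight [s] on [m + t *: g = - u] and weight [t] on [n - s *: g = - u] make the multiples of [g]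
   cancel. *)
have -> : - u = (s + t)^-1 *: (s *: m + t *: n).
  apply: (scalerI (lt0r_neq0 (addr_gt0 s0 t0))).
  rewrite scalerA divff ?scale1r ?lt0r_neq0 ?addr_gt0//.
  rewrite scalerDl -{1}mE -nE !scalerDr !scalerA addrACA.
  by rewrite scalerN [t * s]mulrC subrr addr0.
apply: (MZ); first by rewrite invr_ge0 ltW// addr_gt0.
by apply: MD; apply: MZ => //; exact: ltW.
Qed.

(* The functional sends g to the Dedekind cut of the reals r with g - r u in
   the maximal cone. *)
Lemma positive_functional (R : realType) (V : lmodType R) (A C : set V)
    (u : V) :
  linear_subspace A -> C `<=` A -> convex_cone C ->
  (forall g, A g -> exists2 e : R, 0 < e & C (u + e *: g)) -> ~ C (- u) ->
  exists L : V -> R,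
    [/\ forall (a : R) f g, A f -> A g -> L (a *: f + g) = a * L f + L g,
        forall g, C g -> 0 <= L g & L u = 1].
Proof.
move=> sA CA cC Cu CNu.
have [M [CM MA [M0 MD MZ] MNu Mtot]] := maximal_cone sA CA cC CNu.
have Mu : M u by have [e _] := Cu _ sA.1; rewrite scaler0 addr0 => /CM.
have Au : A u := MA _ Mu.
have AB g r : A g -> A (g - r *: u).
  by move=> Ag; rewrite addrC -scaleNr; exact: sA.2.
have Mscale_ge0 r : M (r *: u) -> 0 <= r.
  move=> Mru; rewrite leNgt; apply/negP => r0; apply: MNu.
  have -> : - u = (- r)^-1 *: (r *: u).
    by rewrite scalerA invrN mulNr mulVf ?scaleN1r// lt_eqF.
  by apply: MZ => //; rewrite invr_ge0 oppr_ge0 ltW.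
(* The inequalities are strict because the known properties of [M] do not force both [g - l *: u]
   and [l *: u - g] into [M]. *)
pose cut g l := (forall r, r < l -> M (g - r *: u)) /\
                (forall r, l < r -> M (r *: u - g)).
have cut_le g l l' : cut g l -> cut g l' -> l <= l'.
  move=> [lM _] [_ Ml']; rewrite leNgt; apply/negP => ll'.
  (* The two points at one third and two thirds of the way from [l'] to [l] give elements of [M]
     whose sum is [((l' - l) / 3) *: u], a negative multiple of [u]. *)
  have Ml : M (g - ((l' + l *+ 2) / 3) *: u) by apply: lM; lra.
  have /MD/(_ Ml) : M (((l' *+ 2 + l) / 3) *: u - g) by apply: Ml'; lra.
  by rewrite addrA subrK -scalerBl => /Mscale_ge0; lra.
have cut_uniq g l l' : cut g l -> cut g l' -> l = l'.
  by move=> gl gl'; apply/eqP; rewrite eq_le !(cut_le g).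
have cutD f g a b : cut f a -> cut g b -> cut (f + g) (a + b).
  move=> [fa af] [gb bg]; split=> r rab.
    (* The difference [r - (a + b)] is shared equally between [f] and [g]. *)
    have -> : f + g - r *: u = (f - ((a - b + r) / 2) *: u) +
                               (g - ((b - a + r) / 2) *: u).
      rewrite addrACA -opprD -scalerDl; congr (_ - _ *: _); lra.
    by apply: MD; [apply: fa|apply: gb]; lra.
  have -> : r *: u - (f + g) = (((a - b + r) / 2) *: u - f) +
                               (((b - a + r) / 2) *: u - g).
    rewrite addrACA -opprD -scalerDl; congr (_ *: _ - _); lra.
  by apply: MD; [apply: af|apply: bg]; lra.
have cutN g a : cut g a -> cut (- g) (- a).
  move=> [ga ag]; split=> r ra.
    by rewrite -opprD addrC opprD -scaleNr; apply: ag; lra.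
  by rewrite opprK addrC -[r]opprK scaleNr; apply: ga; lra.
have cutZ_gt0 c g a : 0 < c -> cut g a -> cut (c *: g) (c * a).
  move=> c0 [ga ag]; have cN0 : c != 0 by rewrite gt_eqF.
  split=> r ra.
    have -> : c *: g - r *: u = c *: (g - (r / c) *: u).
      by rewrite scalerBr scalerA mulrCA divff// mulr1.
    by apply: MZ; [exact: ltW|apply: ga; rewrite ltr_pdivrMr// mulrC].
  have -> : r *: u - c *: g = c *: ((r / c) *: u - g).
    by rewrite scalerBr scalerA mulrCA divff// mulr1.
  by apply: MZ; [exact: ltW|apply: ag; rewrite ltr_pdivlMr// mulrC].
have cut0 : cut 0 0.
  split=> r r0; first by rewrite sub0r -scaleNr; apply: MZ => //; lra.
  by rewrite subr0; apply: MZ => //; lra.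
have cutZ c g a : cut g a -> cut (c *: g) (c * a).
  move=> ga; have [c0|c0|<-] := ltgtP 0 c; last by rewrite scale0r mul0r.
    exact: cutZ_gt0.
  by rewrite -[c]opprK scaleNr mulNr; apply/cutN/cutZ_gt0; rewrite ?oppr_gt0.
have bound g : A g -> exists l, M (g + l *: u).
  move=> Ag; have [e e0 /CM Mge] := Cu _ Ag; exists e^-1.
  have -> : g + e^-1 *: u = e^-1 *: (u + e *: g).
    by rewrite scalerDr scalerA mulVf ?scale1r 1?addrC// gt_eqF.
  by apply: MZ => //; rewrite invr_ge0 ltW.
have cut_exists g : A g -> exists l, cut g l.
  (* The cut is at [sup S]: [bound] for [g] makes [S] nonempty, and [bound] for [- g] bounds it
     above. Below the supremum, a positive multiple of [u] is added to an element of [M]; above it,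
     totality of [M] applies. *)
  move=> Ag; pose S := [set r | M (g - r *: u)].
  have [a Ma] := bound _ Ag.
  have [b Mb] : exists b, M (- g + b *: u).
    by apply: bound; rewrite -scaleN1r; exact: linear_subspaceZ.
  have Sub : ubound S b.
    move=> r /MD/(_ Mb); rewrite addrACA subrr add0r addrC -scalerBl.
    by move=> /Mscale_ge0; rewrite subr_ge0.
  have supS : has_sup S.
    by split; [exists (- a); rewrite /S/= scaleNr opprK|exists b].
  exists (sup S); split=> r.
    move=> /(sup_gt supS.1)[s Ss rs].
    have -> : g - r *: u = (g - s *: u) + (s - r) *: u.
      by rewrite scalerBl addrA subrK.
    by apply: MD => //; apply: MZ => //; rewrite subr_ge0 ltW.
  move=> Sr; have [/(ub_le_sup supS.2)|] := Mtot _ (AB g r Ag).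
    by rewrite leNgt Sr.
  by rewrite opprB.
(* The default [0] is never taken on [A], where every [g] has a cut. *)
pose L g := xget 0 (cut g).
have cutL g : A g -> cut g (L g).
  by move=> /cut_exists[l gl]; exact: xgetPex (ex_intro _ l gl).
exists L; split.
- move=> a f g Af Ag; apply: (cut_uniq (a *: f + g)).
    by apply: cutL; exact: sA.2.
  by apply: cutD; [apply: cutZ|]; exact: cutL.
- move=> g Cg; have [_ Lg] := cutL g (CA _ Cg).
  (* If [L g < 0], then [(L g / 2) *: u - g] lies in [M]; adding [g] leaves a negative multiple of
     [u] in [M]. *)
  rewrite leNgt; apply/negP => L0.
  have /Lg/MD/(_ (CM _ Cg)) : L g < L g / 2 by lra.
  by rewrite subrK => /Mscale_ge0; lra.
- apply: (cut_uniq u); first exact: cutL.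
  split=> r r1; first by rewrite -{1}[u]scale1r -scalerBl; apply: MZ => //; lra.
  by rewrite -{2}[u]scale1r -scalerBl; apply: MZ => //; lra.
Qed.

(** * Quadratic modules and positivity sets *)

Lemma subalgebra_subspace (R : realType) (T : Type) (A : set (T -> R)) :
  unital_subalgebra A -> linear_subspace A.
Proof.
move=> [A1 AD _]; split=> //.
by rewrite -[0](addNr (1 : T -> R)) -scaleN1r; exact: AD.
Qed.

Lemma generated_algebra_subalgebra (R : realType) (T : Type)
    (G : set (T -> R)) :
  unital_subalgebra (generated_algebra G).
Proof.
split=> [|a f g Af Ag|f g Af Ag].
- by move=> B [[]].
- by move=> B BG; have [[_ BD _] _] := BG; apply: BD; [exact: Af|exact: Ag].
- by move=> B BG; have [[_ _ BM] _] := BG; apply: BM; [exact: Af|exact: Ag].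
Qed.

(** A nonnegative scalar is the square of a constant function, and constants belong to [A]. *)
Lemma quadratic_module_cone (R : realType) (T : Type) (A Q : set (T -> R)) :
  unital_subalgebra A -> quadratic_module A Q -> convex_cone Q.
Proof.
move=> sA [_ Q1 QD Qsqr]; have sA' := subalgebra_subspace sA.
have QZ (t : R) q : 0 <= t -> Q q -> Q (t *: q).
  move=> t0 Qq; have -> : t *: q = (Num.sqrt t *: (1 : T -> R) : T -> R) ^+ 2 * q.
    apply/funext => x; rewrite expr2.
    change (t * q x = Num.sqrt t * 1 * (Num.sqrt t * 1) * q x).
    by rewrite mulr1 -expr2 sqr_sqrtr.
  by apply: Qsqr => //; apply: linear_subspaceZ => //; have [] := sA.
by split=> //; rewrite -(scale0r (1 : T -> R)); exact: QZ.
Qed.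

(** For a fixed [x], the elements of [A] that are nonnegative at [x] form a quadratic module, so it
    contains the one generated by [F] as soon as it contains [F]. *)
Lemma positivity_set_generated (R : realType) (T : Type)
    (A F : set (T -> R)) :
  unital_subalgebra A -> F `<=` A ->
  positivity_set (generated_quadratic_module A F) = positivity_set F.
Proof.
move=> [A1 AD AM] FA; apply/seteqP; split=> x Px.
  by move=> q Fq; apply: Px => B [_]; exact.
move=> q Qq; suff [] : [set q | A q /\ 0 <= q x] q by [].
apply: Qq.
split; last by move=> p Fp; split; [exact: FA|exact: Px].
split=> [p []//|||].
- by split => //; exact: ler01.
- move=> p1 p2 [Ap1 p1x] [Ap2 p2x]; split; last exact: addr_ge0.
  by rewrite -[p1]scale1r; exact: AD.
- move=> a p Aa [Ap px]; split; last first.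
    rewrite expr2; change (0 <= a x * a x * p x).
    by rewrite -expr2 mulr_ge0 ?sqr_ge0.
  by apply: (AM) => //; rewrite expr2; exact: AM.
Qed.

(** * Measurability and integration *)

Lemma measurable_positivity_set (R : realType) (disp : measure_display)
    (T : measurableType disp) (F : set (T -> R)) :
  countable F -> (forall g, F g -> measurable_fun setT g) ->
  measurable (positivity_set F).
Proof.
move=> cF mF.
have -> : positivity_set F = \bigcap_(q in F) (q @^-1` `[0, +oo[).
  by apply/seteqP; split=> x Px q Fq; have := Px q Fq; rewrite /= in_itv/= andbT.
rewrite -[X in measurable X]setCK setC_bigcap; apply: measurableC.
(* Indexing the union by the subtype of [F] makes the index type countable. *)
rewrite bigcup_set_type; apply: countable_bigcupT_measurable => [|q].
  by rewrite (eq_countable (card_setT _)).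
apply: measurableC; rewrite -[X in measurable X]setTI.
by apply: mF => //; exact: set_valP.
Qed.

(** On [D] the function equals its absolute value, so the integral of the latter vanishes and [f] is
    zero almost everywhere on [D]; but [f] has no zero there. *)
Lemma measure0_integral_le0 (R : realType) (disp : measure_display)
    (T : measurableType disp) (mu : {measure set T -> \bar R}) (D : set T)
    (f : T -> R) :
  measurable D -> measurable_fun D f -> (forall x, D x -> 0 < f x) ->
  (\int[mu]_(x in D) (f x)%:E <= 0)%E -> mu D = 0%E.
Proof.
move=> mD mf f0 int_le0.
have /measurable_EFinP mEf := mf.
have int_eq0 : (\int[mu]_(x in D) `|(f x)%:E| = 0)%E.
  apply/eqP; rewrite eq_le integral_ge0 ?andbT//.
  under eq_integral => x /set_mem Dx.
    by rewrite gee0_abs; [over|rewrite lee_fin ltW// f0].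
  exact: int_le0.
have [N [mN muN DN]] := (ae_eq_integral_abs mu mD mEf).1 int_eq0.
apply: (subset_measure0 mD mN) => // x Dx; apply: DN => /(_ Dx)/= [fx0].
by have := f0 _ Dx; rewrite fx0 ltxx.
Qed.

Theorem theorem2p1 (R : realType) (d m : nat) (d_ge1 : (1 <= d)%N)
    (h : 'I_m -> borelRd R d -> R)
    (mh : forall j, measurable_fun setT (h j))
    (Q : set (borelRd R d -> R))
    (Qquad : quadratic_module (algebra_of h) Q)
    (Qcount : countably_generated (algebra_of h) Q)
    (Qarch : archimedean (algebra_of h) Q)
    (Qmoment : moment_property (algebra_of h) Q)
    (f : borelRd R d -> R) (fA : algebra_of h f)
    (fpos : forall x, positivity_set Q x -> 0 < f x) :
  Q f.
Proof.
have algA : unital_subalgebra (algebra_of h).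
  exact: generated_algebra_subalgebra.
move: (algebra_of h) algA Qquad Qcount Qarch Qmoment fA => A.
move=> algA Qquad [F [cF FA QE]] Qarch Qmoment fA.
have sA := subalgebra_subspace algA.
have [Q0 QD QZ] := quadratic_module_cone algA Qquad.
have [QA Q1 _ _] := Qquad.
apply: contrapT => nQf.
pose C := [set g | exists q, exists2 t : R, Q q /\ 0 <= t & g = q - t *: f].
have QC : Q `<=` C.
  by move=> q Qq; exists q, 0; rewrite ?scale0r ?subr0.
have [L [Llin Lge0 L1]] : exists L : (borelRd R d -> R) -> R,
    [/\ forall (a : R) f g, A f -> A g -> L (a *: f + g) = a * L f + L g,
        forall g, C g -> 0 <= L g & L 1 = 1].
  apply: (positive_functional sA (C := C)).
  - move=> _ [q [t [Qq t0] ->]]; rewrite addrC -scaleNr.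
    by apply: sA.2 => //; exact: QA.
  - split; first exact: QC.
    + move=> _ _ [p [t [Qp t0] ->]] [q [s [Qq s0] ->]].
      exists (p + q), (t + s); last by rewrite addrACA -opprD scalerDl.
      by split; [exact: QD|exact: addr_ge0].
    + move=> a _ a0 [q [t [Qq t0] ->]]; exists (a *: q), (a * t).
        by split; [exact: QZ|exact: mulr_ge0].
      by rewrite scalerBr scalerA.
  - move=> g /Qarch[e e0 He]; exists e => //; apply/QC/He.
    by rewrite lexx ltW.
  (* When [t = 0], [q] is [- 1] and cancels the [1] in [1 + e *: f], leaving a positive multiple of
     [f] in [Q]. *)
  - move=> [q [t [Qq]]]; rewrite le_eqVlt => /predU1P[<-|t0] qE; apply: nQf.
      have [e e0 He] := Qarch _ fA.
      have -> : f = e^-1 *: ((1 + e *: f) + q).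
        move: qE; rewrite scale0r subr0 => <-.
        by rewrite addrAC subrr add0r scalerA mulVf ?scale1r ?gt_eqF.
      apply: QZ; first by rewrite invr_ge0 ltW.
      by apply: QD => //; apply: He; rewrite lexx ltW.
    have -> : f = t^-1 *: (1 + q).
      have -> : q = - 1 + t *: f by rewrite qE subrK.
      by rewrite addrA subrr add0r scalerA mulVf ?scale1r ?gt_eqF.
    by apply: QZ; [rewrite invr_ge0 ltW|exact: QD].
have [mu [_ muP]] := Qmoment L Llin (fun q Qq => Lge0 q (QC q Qq)).
have mA g : A g -> measurable_fun setT g.
  by move=> /muP[/measurable_int /measurable_EFinP].
(* [Q] may be uncountable, so its positivity set is computed from the countable set [F]. *)
have mP : measurable (positivity_set Q).
  rewrite QE positivity_set_generated//.
  by apply: measurable_positivity_set => // g /FA/mA.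
have Lf : L f <= 0.
  have : 0 <= L (- f).
    by apply: Lge0; exists 0, 1; [split|rewrite scale1r sub0r].
  have := Llin (-1) f 0 fA sA.1; rewrite addr0 scaleN1r => ->.
  (* This instance reads [L 0 = L 0 + L 0], hence [L 0 = 0]. *)
  have := Llin 1 0 0 sA.1 sA.1; rewrite scaler0 addr0; lra.
have muP0 : mu (positivity_set Q) = 0%E.
  apply: (measure0_integral_le0 (f := f)) => //.
    exact: measurable_funS (mA _ fA).
  by rewrite -(muP f fA).2 lee_fin.
have [A1 _ _] := algA.
(* Integrating the constant [1] gives the total mass of [positivity_set Q], so [1 = 0]. *)
have := (muP 1 A1).2; rewrite L1.
rewrite (_ : (fun x => _) = cst 1%E)// integral_cst// muP0 mule0 => -[] /eqP.
by rewrite oner_eq0.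
Qed.
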